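(* Let $(X,f)$ be a dynamical system where $X$ is a compact Hausdorff space. Then $(X,f)$ has the second weak shadowing property.
   Context: A dynamical system is a pair $(X,f)$ with $X$ a (nonempty) compact Hausdorff space and $f\colon X\to X$ a continuous function. A compact Hausdorff space has a unique uniformity $\mathscr{U}$ inducing its topology. Since symmetric entourages form a base for $\mathscr{U}$, all entourages referred to are taken to be symmetric ($E=E^{-1}$). For $E\in\mathscr{U}$, $x\in X$ and $A\subseteq X$: $B_E(x)=\{y\in X \mid (x,y)\in E\}$ and $B_E(A)=\bigcup_{x\in A}B_E(x)$. For $D\in\mathscr{U}$, a $D$-pseudo-orbit is a sequence $(x_i)_{i\ge 0}$ in $X$ with $(f(x_i),x_{i+1})\in D$ for all $i\ge 0$. The orbit of $z\in X$ is $\mathrm{Orb}(z)=\{z,f(z),f^2(z),\ldots\}$. The system $(X,f)$ has second weak shadowing (the second weak shadowing property) if for all $E\in\mathscr{U}$ there exists $D\in\mathscr{U}$ such that for any $D$-pseudo-orbit $(x_i)_{i\ge 0}$ there exists a point $z\in X$ such that $\mathrm{Orb}(z)\subseteq B_E\left(\{x_i\}_{i\ge 0}\right)$. *)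

(* Defs.v *)
From HB Require Import structures.
From mathcomp Require Import all_boot all_classical all_analysis.

Set Implicit Arguments.
Unset Strict Implicit.
Unset Printing Implicit Defensive.

Local Open Scope classical_set_scope.
Local Open Scope relation_scope.

(* The unique uniformity of a compact Hausdorff space is rendered by taking the
   space to be a [uniformType]: its entourages always induce its topology. *)

Definition sym_entourage (X : uniformType) (E : set (X * X)) : Prop :=
  entourage E /\ E^-1 = E.

(* [xsection E x] is the set of all [y] with [(x, y)] in [E]. *)
Definition entourage_nbhd (X : Type) (E : set (X * X)) (A : set X) : set X :=
  \bigcup_(x in A) xsection E x.

Definition pseudo_orbit (X : Type) (f : X -> X) (D : set (X * X))
    (x : nat -> X) : Prop :=
  forall i, D (f (x i), x i.+1).

Definition Orb (X : Type) (f : X -> X) (z : X) : set X :=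
  range (fun n => iter n f z).

Definition second_weak_shadowing (X : uniformType) (f : X -> X) : Prop :=
  forall E, sym_entourage E ->
  exists2 D, sym_entourage D &
  forall x, pseudo_orbit f D x ->
  exists z, Orb f z `<=` entourage_nbhd E (range x).

(* Main.v *)
Require Import Defs.
From mathcomp Require Import all_boot all_classical all_analysis.

Set Implicit Arguments.
Unset Strict Implicit.
Unset Printing Implicit Defensive.

Local Open Scope classical_set_scope.

(** Suppose that some entourage [E] defeats every [D]: each [D] then has a
    [D]-pseudo-orbit whose [E]-neighbourhood contains no orbit at all.  These
    pseudo-orbits, indexed by [D], generate a proper filter on the space of
    sequences, which extends to an ultrafilter [G].  Let [K] be the lower limit
    along [G] of the sets of terms: [y] is in [K] when each neighbourhood of [y]
    is met by [G]-almost every sequence ([lower_limit]).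

    - [K] is closed, hence compact ([closed_lower_limit]).
    - [K] is nonempty: by compactness and because [G] is an ultrafilter, the
      initial terms of the sequences accumulate at a point of [K]
      ([lower_limit_nonempty]).
    - [K] is forward invariant: if a sequence has a term near [y] and small
      jumps, its next term is near [f y] ([lower_limit_invariant]).
    - By compactness, [K] lies in the [E]-neighbourhood of the terms of
      [G]-almost every sequence ([lower_limit_sub_nbhd]).

    The orbit of any [z] in [K] stays in [K], so it lies in the
    [E]-neighbourhood of one of the sequences, which is the contradiction
    sought. *)

(** The lower (Kuratowski) limit, along a filter [G] on sequences, of the sets
    of terms of the sequences. *)
Definition lower_limit (X : topologicalType) (G : set_system (nat -> X)) :
    set X :=
  [set y | forall V, nbhs y V -> \forall x \near G, exists i, V (x i)].

Lemma closed_lower_limit (X : topologicalType) (G : set_system (nat -> X))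
    (FG : Filter G) :
  closed (lower_limit G).
Proof.
move=> y Ky V yV.
have [y' [Ky' Vy']] := Ky _ (nbhs_interior yV).
exact: Ky' Vy'.
Qed.

Lemma lower_limit_nonempty (X : topologicalType) (G : set_system (nat -> X))
    (UG : UltraFilter G) :
  compact [set: X] -> lower_limit G !=set0.
Proof.
move=> /(_ ((fun x => x 0) @ G) _ filterT)[p [_ pcl]].
exists p => V pV; have [GV|GnV] := in_ultra_setVsetC [set x | V (x 0)] UG.
  by apply: filterS GV => x Vx; exists 0.
by have [q [/= nVq Vq]] := pcl (~` V) V GnV pV.
Qed.

Lemma lower_limit_invariant (X : uniformType) (f : X -> X)
    (G : set_system (nat -> X)) (FG : Filter G) (y : X) :
  {for y, continuous f} ->
  (forall D, entourage D -> \forall x \near G, pseudo_orbit f D x) ->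
  lower_limit G y -> lower_limit G (f y).
Proof.
move=> fy Gf Ky V /nbhsP[A entA AV].
have entB := entourage_split_ent entA.
have yB := fy _ (nbhs_entourage (f y) entB).
apply: filterS2 (Ky _ yB) (Gf _ entB) => x [i /xsectionP Bi] Dx.
exists i.+1; apply: AV; apply/xsectionP.
exact: entourage_split entA Bi (Dx i).
Qed.

Lemma lower_limit_sub_nbhd (X : uniformType) (G : set_system (nat -> X))
    (FG : Filter G) (E : set (X * X)) :
  compact [set: X] -> sym_entourage E ->
  \forall x \near G, lower_limit G `<=` entourage_nbhd E (range x).
Proof.
move=> Xc [entE symE].
have Kc : compact (lower_limit G).
  by apply: subclosed_compact Xc _ => //; exact: closed_lower_limit.
(* Compactness makes the choice of [x] uniform over the lower limit: it is
   enough to treat all points [y'] near a fixed [y] of it. *)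
have /compact_near_coveringP Knc := Kc.
apply: (Knc _ _ (fun x y => entourage_nbhd E (range x) y)) => y Ky.
have entB := entourage_split_ent entE.
have yB := nbhs_entourage y entB.
have yB' := nbhs_entourage y (entourage_inv entB).
exists (xsection (split_ent E)^-1%relation y,
        [set x | exists i, xsection (split_ent E) y (x i)]).
  by split => //; exact: Ky.
move=> [y' x] /= [/xsectionP yy' [i /xsectionP yx]].
exists (x i); first by exists i.
by apply/xsectionP; rewrite -symE; exact: entourage_split entE yy' yx.
Qed.

Theorem corollary2p4 (X : uniformType) (f : X -> X)
    (X_nonempty : [set: X] !=set0)
    (X_compact : compact [set: X])
    (X_hausdorff : hausdorff_space X)
    (f_continuous : continuous f) :
  second_weak_shadowing f.
Proof.
move=> E symE; apply: contrapT => noD.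
pose bad D := [set x | pseudo_orbit f D x /\
  ~ exists z, Orb f z `<=` entourage_nbhd E (range x)].
have bad_nonempty D : entourage D -> bad D !=set0.
  move=> entD; apply: contrapT => bad0; apply: noD.
  exists (D `&` D^-1)%relation.
    by split; [exact: entourage_invI|rewrite eqEsubset; split=> -[a b] []].
  move=> x Dx; apply: contrapT => nz; apply: bad0; exists x; split=> // i.
  by have [] := Dx i.
have badF : ProperFilter (filter_from entourage bad).
  apply: filter_from_proper => //; apply: filter_from_filter.
    by exists setT; exact: entourageT.
  move=> A B entA entB; exists (A `&` B); first exact: filterI.
  by move=> x [ABx nz]; split; split=> // i; have [] := ABx i.
have [G [UG badG]] := ultraFilterLemma badF.
have Gbad D : entourage D -> G (bad D) by move=> entD; apply: badG; exists D.
have Gpo D : entourage D -> \forall x \near G, pseudo_orbit f D x.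
  by move=> /Gbad; apply: filterS => x [].
have [z Kz] := lower_limit_nonempty UG X_compact.
have Korb n : lower_limit G (iter n f z).
  elim: n => //= n; apply: lower_limit_invariant => //.
  exact: f_continuous.
have GK : \forall x \near G, lower_limit G `<=` entourage_nbhd E (range x).
  exact: lower_limit_sub_nbhd.
have [x [[_ nz] xK]] := filter_ex (filterI (Gbad _ entourageT) GK).
by apply: nz; exists z => _ [n _ <-]; exact/xK/Korb.
Qed.
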